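(* The multiplication of $\mathbb{V}_7$ is uniquely determined by the subgroup lattice of $(\mathbb{Z}/2)^3$ together with the subalgebra rules, in the following sense. There is a unique bilinear product $\ast$ on $\mathbb{R}^7$ satisfying the following rules for every subgroup $H\le(\mathbb{Z}/2)^3$ of order $4$, with $W_H=\mathrm{Span}_{\mathbb{R}}(H\setminus\{0\})$: (a) if $e_1\in H$, then $e_1$ is a two-sided unit for $\ast$ on $W_H$, and for the two distinct elements $e_j,e_k\in H\setminus\{0,e_1\}$ one has $e_j\ast e_j=e_k\ast e_k=-e_1$, $e_j\ast e_k=\varepsilon(j,k)e_1$ and $e_k\ast e_j=\varepsilon(k,j)e_1$ (so $W_H$ is a copy of $\mathbb{V}_3$); (b) if $e_1\notin H$, then $e_1$ is a two-sided unit for $\ast$ on $\mathbb{R}e_1\oplus W_H$, and $a\ast b=-\langle a,b\rangle e_1$ for all $a,b\in W_H$. This unique product is the multiplication $\veebar_7$ of $\mathbb{V}_7$.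
   Context: Let $\{e_1,\dots,e_7\}$ be the standard orthonormal basis of $\mathbb{R}^7$ with Euclidean inner product $\langle\cdot,\cdot\rangle$, dual basis $\omega^1,\dots,\omega^7$, and $\omega^{ijk}=\omega^i\wedge\omega^j\wedge\omega^k$. Let $$\Phi=\omega^{123}+\omega^{145}+\omega^{167}+\omega^{246}-\omega^{257}-\omega^{347}-\omega^{356},$$ and let $\times$ be the bilinear cross product on $\mathbb{R}^7$ characterized by $\langle u\times v,w\rangle=\Phi(u,v,w)$. The exceptional Vidinli algebra $\mathbb{V}_7=(\mathbb{R}^7,\veebar_7)$ has the bilinear product $$a\veebar_7 b=\langle a,e_1\rangle b+\langle b,e_1\rangle a-\langle a,b\rangle e_1+\langle e_1,a\times b\rangle e_1 .$$ The basis vectors (and their indices) are identified with the nonzero elements of $(\mathbb{Z}/2)^3$ via $e_1\leftrightarrow(1,0,0)$, $e_2\leftrightarrow(0,1,0)$, $e_3\leftrightarrow(1,1,0)$, $e_4\leftrightarrow(0,0,1)$, $e_5\leftrightarrow(1,0,1)$, $e_6\leftrightarrow(0,1,1)$, $e_7\leftrightarrow(1,1,1)$. For distinct $j,k$, $\varepsilon(j,k)\in\{+1,-1\}$ is the sign defined by $e_j\times e_k=\varepsilon(j,k)e_{j+k}$, with $j+k$ computed in $(\mathbb{Z}/2)^3$. $\mathbb{V}_3$ is $\mathbb{R}^3$ with the product given by the same formula $\langle a,e_1\rangle b+\langle b,e_1\rangle a-\langle a,b\rangle e_1+\langle e_1,a\times b\rangle e_1$ using the standard cross product of $\mathbb{R}^3$.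 *)

(* Defs.v *)
From HB Require Import structures.
From mathcomp Require Import all_boot all_order all_fingroup all_algebra.
From mathcomp Require Import reals ring.

Set Implicit Arguments.
Unset Strict Implicit.
Unset Printing Implicit Defensive.

Import GRing.Theory Num.Theory.
Local Open Scope ring_scope.

(* Mathematical indices start at 1, ordinals at 0: e_i, omega^i and the i-th  *)
(* coordinate correspond to the ordinal of value i - 1.  The combinatorial    *)
(* part is indexed by ordinals, the formula of Phi by the numbers 1, ..., 7.  *)

Section Euclidean.
Variables (R : realType) (n : nat).
Implicit Types u v : 'rV[R]_n.+1.

Definition dot u v : R := \sum_i u 0 i * v 0 i.

Definition basis (i : 'I_n.+1) : 'rV[R]_n.+1 := delta_mx 0 i.

Definition is_bilinear (f : 'rV[R]_n.+1 -> 'rV[R]_n.+1 -> 'rV[R]_n.+1) : Prop :=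
  (forall b, linear (f^~ b)) /\ (forall a, linear (f a)).

Definition vidinli (cross : 'rV[R]_n.+1 -> 'rV[R]_n.+1 -> 'rV[R]_n.+1)
    (a b : 'rV[R]_n.+1) : 'rV[R]_n.+1 :=
  let e1 := basis ord0 in
  dot a e1 *: b + dot b e1 *: a - dot a b *: e1 + dot e1 (cross a b) *: e1.

End Euclidean.

Section CrossProducts.
Variable R : realType.

(* Indices are added modulo 3. *)
Definition cross3 (a b : 'rV[R]_3) : 'rV[R]_3 :=
  \row_(k < 3) (a 0 (k + 1) * b 0 (k + 2%:R) - a 0 (k + 2%:R) * b 0 (k + 1)).

Definition vee3 : 'rV[R]_3 -> 'rV[R]_3 -> 'rV[R]_3 := vidinli cross3.

(* omega^{ijk}(u, v, w), with the convention                                  *)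
(* (a /\ b /\ c)(u, v, w) = det of the values of a, b, c at u, v, w.          *)
Definition omega (i j k : nat) (u v w : 'rV[R]_7) : R :=
  \det (\matrix_(r < 3, s < 3)
    tnth [tuple u; v; w] r 0 (inord (tnth [tuple i; j; k] s).-1)).

Definition Phi (u v w : 'rV[R]_7) : R :=
  omega 1 2 3 u v w + omega 1 4 5 u v w + omega 1 6 7 u v w
  + omega 2 4 6 u v w - omega 2 5 7 u v w - omega 3 4 7 u v w
  - omega 3 5 6 u v w.

(* The vector representing the linear form Phi(u, v, -); see cross7P. *)
Definition cross7 (u v : 'rV[R]_7) : 'rV[R]_7 := \row_k Phi u v (basis R k).

Definition vee7 : 'rV[R]_7 -> 'rV[R]_7 -> 'rV[R]_7 := vidinli cross7.

End CrossProducts.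

(* The group law is addition. *)
Definition cube : finGroupType := 'rV['Z_2]_3.

Definition label (i : 'I_7) : cube :=
  \row_(l < 3) (tnth (tnth [tuple
    [tuple 1; 0; 0]; [tuple 0; 1; 0]; [tuple 1; 1; 0]; [tuple 0; 0; 1];
    [tuple 1; 0; 1]; [tuple 0; 1; 1]; [tuple 1; 1; 1]] i) l).

(* The inverse of label on nonzero elements; the value at 0 is irrelevant. *)
Definition idx (g : cube) : 'I_7 := odflt ord0 [pick i | label i == g].

Section Rules.
Variable R : realType.
Local Notation V := 'rV[R]_7.
Implicit Types (mul : V -> V -> V) (H : {group cube}) (W : {vspace V}).

Local Notation e := (basis R).
Local Notation e1 := (basis R (ord0 : 'I_7)).

(* Only meaningful for j != k; see eps_cross7. *)
Definition eps (j k : 'I_7) : R :=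
  if cross7 (e j) (e k) == e (idx (label j + label k)) then 1 else -1.

Definition subgroup_span H : {vspace V} :=
  span [seq e (idx g) | g in H :\ (0 : cube)].

Definition unit_on mul W : Prop := forall a, a \in W -> mul e1 a = a /\ mul a e1 = a.

Definition rule_a mul H : Prop :=
  unit_on mul (subgroup_span H) /\
  forall j k : 'I_7, label j \in H -> label k \in H ->
    j != ord0 -> k != ord0 -> j != k ->
    [/\ mul (e j) (e j) = - e1, mul (e k) (e k) = - e1,
        mul (e j) (e k) = eps j k *: e1 & mul (e k) (e j) = eps k j *: e1].

Definition rule_b mul H : Prop :=
  unit_on mul (<[e1]> + subgroup_span H)%VS /\
  {in subgroup_span H &, forall a b, mul a b = - (dot a b *: e1)}.

Definition subalgebra_rules mul : Prop :=
  forall H, #|H| = 4%N ->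
    (label ord0 \in H -> rule_a mul H) /\ (label ord0 \notin H -> rule_b mul H).

Definition copy_of_V3 mul W : Prop :=
  exists f : 'Hom('rV[R]_3, V),
    [/\ lker f = 0%VS, limg f = W & forall a b, f (vee3 a b) = mul (f a) (f b)].

End Rules.

(* The facts below check the encodings: label and idx are mutually inverse    *)
(* (labelK, idxK), cross7 has the characteristic property of the cross        *)
(* product (cross7P), and eps is the sign in e_j x e_k (eps_cross7).          *)

Lemma labelE i l : label i 0 l = (odd (i.+1 %/ 2 ^ l))%:R.
Proof.
rewrite mxE; apply/eqP.
by case: i l => -[|[|[|[|[|[|[|//]]]]]]] ? [[|[|[|//]]] ?].
Qed.

Lemma bool_Z2_inj (a b : bool) : a%:R = b%:R :> 'Z_2 -> a = b.
Proof. by case: a; case: b => // /eqP. Qed.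

(* Row j and column k (from 0) hold the 1-based sum of e_(j+1) and e_(k+1). *)
Definition xor_idx (j k : nat) : nat := (nth 0 (nth [::]
  [:: [:: 0;3;2;5;4;7;6]; [:: 3;0;1;6;7;4;5]; [:: 2;1;0;7;6;5;4];
      [:: 5;6;7;0;1;2;3]; [:: 4;7;6;1;0;3;2]; [:: 7;4;5;2;3;0;1];
      [:: 6;5;4;3;2;1;0]] j) k)%N.

Lemma all7 (P : pred nat) : all P (iota 0 7) -> forall i : 'I_7, P i.
Proof. by move=> /allP h i; apply: h; rewrite mem_iota ltn_ord. Qed.

Lemma all77 (P : rel nat) :
  all (fun i => all (P i) (iota 0 7)) (iota 0 7) -> forall i j : 'I_7, P i j.
Proof. by move=> h i j; have /all7 := all7 h i; apply. Qed.

Lemma label_inj : injective label.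
Proof.
move=> i j /rowP h; apply/val_inj/eqP.
have {}h (l : 'I_3) : odd (i.+1 %/ 2 ^ l) = odd (j.+1 %/ 2 ^ l).
  by apply: bool_Z2_inj; rewrite -!labelE.
move: (h (Ordinal (isT : 0 < 3)%N)) (h (Ordinal (isT : 1 < 3)%N)) (h (Ordinal (isT : 2 < 3)%N)) => /= /eqP h0 /eqP h1 /eqP h2.
have := @all77 (fun i j => [==> odd (i.+1 %/ 2 ^ 0) == odd (j.+1 %/ 2 ^ 0),
  odd (i.+1 %/ 2 ^ 1) == odd (j.+1 %/ 2 ^ 1), odd (i.+1 %/ 2 ^ 2) == odd (j.+1 %/ 2 ^ 2) => i == j]) isT i j.
by rewrite h0 h1 h2.
Qed.

Lemma label_neq0 i : label i != 0.
Proof.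
apply/eqP => /rowP h.
have {}h (l : 'I_3) : odd (i.+1 %/ 2 ^ l) = false.
  by apply: bool_Z2_inj; rewrite -!labelE h mxE.
have := @all7 (fun i => [|| odd (i.+1 %/ 2 ^ 0), odd (i.+1 %/ 2 ^ 1) | odd (i.+1 %/ 2 ^ 2)]) isT i.
by rewrite (h (Ordinal (isT : 0 < 3)%N)) (h (Ordinal (isT : 1 < 3)%N)) (h (Ordinal (isT : 2 < 3)%N)).
Qed.

Lemma labelK : cancel label idx.
Proof.
move=> i; rewrite /idx; case: pickP => [j /eqP/label_inj //|/(_ i)]; by rewrite eqxx.
Qed.

Lemma idxK g : g != 0 -> label (idx g) = g.
Proof.
move=> g0; rewrite /idx; case: pickP => [j /eqP //|] h; exfalso.
have : codom label =i predC1 (0 : cube).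
  apply/subset_cardP.
    rewrite (card_codom label_inj) card_ord cardC1.
    by rewrite card_mx card_ord.
  by apply/subsetP=> _ /codomP [i ->]; rewrite inE label_neq0.
move/(_ g); rewrite inE g0 => /codomP [i gi].
by have := h i; rewrite gi eqxx.
Qed.
Section Facts.
Variable R : realType.

Lemma omegaE i j k (u v w : 'rV[R]_7) :
  let a := inord i.-1 in let b := inord j.-1 in let c := inord k.-1 in
  omega i j k u v w = u 0 a * v 0 b * w 0 c + u 0 b * v 0 c * w 0 a
    + u 0 c * v 0 a * w 0 b - u 0 a * v 0 c * w 0 b - u 0 b * v 0 a * w 0 c
    - u 0 c * v 0 b * w 0 a.
Proof.
move=> a b c; rewrite /omega (expand_det_row _ ord0) !big_ord_recl big_ord0 /cofactor.
rewrite !(expand_det_row _ ord0) !big_ord_recl !big_ord0 /cofactor !det_mx11 !mxE /=.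
rewrite /tnth /= /bump /= -/a -/b -/c; ring.
Qed.


Lemma omega_dot i j k (u v w : 'rV[R]_7) :
  \sum_l omega i j k u v (basis R l) * w 0 l = omega i j k u v w.
Proof.
have D (A : R) (a : 'I_7) : A * w 0 a = \sum_l A * (basis R l) 0 a * w 0 l.
  rewrite (bigD1 a) //= mxE !eqxx mulr1 big1 ?addr0 // => l la.
  by rewrite mxE eqxx eq_sym (negPf la) mulr0 mul0r.
rewrite [RHS]omegaE !D -!(sumrN, big_split) /=.
by apply: eq_bigr => l _; rewrite omegaE; ring.
Qed.

Lemma cross7P (u v w : 'rV[R]_7) : dot (cross7 u v) w = Phi u v w.
Proof.
rewrite /dot /Phi -!omega_dot -!(sumrN, big_split) /=.
by apply: eq_bigr => l _; rewrite mxE /Phi !(mulrDl, mulNr).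
Qed.

Definition omegaZ (i j k : nat) (a b c : nat) : int :=
  let d (m n : nat) : int := if m == n then 1 else 0 in
  d a i.-1 * d b j.-1 * d c k.-1 + d a j.-1 * d b k.-1 * d c i.-1
  + d a k.-1 * d b i.-1 * d c j.-1 - d a i.-1 * d b k.-1 * d c j.-1
  - d a j.-1 * d b i.-1 * d c k.-1 - d a k.-1 * d b j.-1 * d c i.-1.
Definition PhiZ a b c := omegaZ 1 2 3 a b c + omegaZ 1 4 5 a b c + omegaZ 1 6 7 a b c
  + omegaZ 2 4 6 a b c - omegaZ 2 5 7 a b c - omegaZ 3 4 7 a b c
  - omegaZ 3 5 6 a b c.

Lemma omega_basis i j k (a b c : 'I_7) : (i <= 7)%N -> (j <= 7)%N -> (k <= 7)%N ->
  omega i j k (basis R a) (basis R b) (basis R c) = (omegaZ i j k a b c)%:~R.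
Proof.
have E (m : 'I_7) n : (n <= 7)%N ->
    basis R m 0 (inord n.-1) = (if m == n.-1 :> nat then 1 else 0 : int)%:~R.
  move=> n7; rewrite mxE eqxx -val_eqE /= inordK; last by case: n n7.
  by rewrite eq_sym; case: eqP.
by move=> i7 j7 k7; rewrite omegaE !E // /omegaZ !(rmorphB, rmorphD, rmorphM) /=.
Qed.

Lemma Phi_basis (a b c : 'I_7) :
  Phi (basis R a) (basis R b) (basis R c) = (PhiZ a b c)%:~R.
Proof.
rewrite /Phi !omega_basis // /PhiZ.
do 7![move: (omegaZ _ _ _ _ _ _) => ?].
by rewrite !(rmorphB, rmorphD).
Qed.

Lemma eps_cross7 (j k : 'I_7) : j != k ->
  cross7 (basis R j) (basis R k) = eps R j k *: basis R (idx (label j + label k)).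
Proof.
move=> jk; rewrite /eps; case: eqP => [->|ne]; first by rewrite scale1r.
have xr7 : ((xor_idx j k).-1 < 7)%N.
  exact: (@all77 (fun j k => (xor_idx j k).-1 < 7)%N isT).
pose m := Ordinal xr7.
have E : idx (label j + label k) = m.
  rewrite -(labelK m); congr idx; apply/rowP => l.
  rewrite mxE !labelE /=.
  have /implyP/(_ jk)/and3P[/eqP h0 /eqP h1 /eqP h2] := @all77 (fun j k => (j != k) ==>
     let b i l := odd (i.+1 %/ 2 ^ l) in let x := (xor_idx j k).-1 in
     [&& b x 0 == b j 0 (+) b k 0, b x 1 == b j 1 (+) b k 1 & b x 2 == b j 2 (+) b k 2])%N isT j k.
  have -> : odd ((xor_idx j k).-1.+1 %/ 2 ^ l) = odd (j.+1 %/ 2 ^ l) (+) odd (k.+1 %/ 2 ^ l).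
    by case: l => [[|[|[|//]]] ?].
  by apply/eqP; do 2!case: odd.
rewrite E.
have C (s : int) : all (fun l => PhiZ j k l == s * (l == (xor_idx j k).-1)%:R) (iota 0 7) ->
   cross7 (basis R j) (basis R k) = s%:~R *: basis R m.
  move/allP=> h; apply/rowP => l; rewrite !mxE Phi_basis eqxx /=.
  rewrite (eqP (h l _)) ?mem_iota ?ltn_ord // rmorphM /= -val_eqE /=.
  by case: eqP.
have /implyP/(_ jk)/orP[h|h] := @all77 (fun j k => (j != k) ==>
  let x := (xor_idx j k).-1 in
  all (fun l => PhiZ j k l == 1 * (l == x)%:R) (iota 0 7) ||
  all (fun l => PhiZ j k l == -1 * (l == x)%:R) (iota 0 7)) isT j k.
- by case: ne; rewrite E (C _ h) scale1r.
- by rewrite (C _ h).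
Qed.
End Facts.

(* Main.v *)
Require Import Defs.
From mathcomp Require Import all_boot all_order all_fingroup all_algebra.
From mathcomp Require Import boolp reals ring.
Local Open Scope ring_scope.

Set Implicit Arguments.
Unset Strict Implicit.
Unset Printing Implicit Defensive.

Import GRing.Theory.

(** A bilinear product is known once its values on pairs of basis vectors are.
    Any two elements of (Z/2)^3 lie in a common subgroup of order 4
    ([order4_through]), and the rule for that subgroup prescribes the product
    of the two corresponding basis vectors: hence at most one product obeys the
    rules ([rules_determine]).

    That the Vidinli product obeys them ([vee7_rules]) comes down to the last
    term of its formula, the coordinate of [a x b] along [e_1].  On the basis,
    [e_j x e_k] is [e_(j+k)] up to the sign [eps j k], so this coordinate is
    [eps j k] when [j + k] is the label of [e_1] and vanishes otherwise
    ([cross7_basis_ord0]).  A subgroup [H] of order 4 that contains the label of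
    [e_1] is made of 0, that label and two labels [j], [k] with sum that label:
    the sign survives.  When [H] omits it, no two labels in [H] add up to it, so
    the term is zero on the whole span of [H] and only [- <a, b> e_1] remains.

    For the copies of the three-dimensional algebra ([vee7_copy_of_V3]), order
    the two labels [j], [k] above so that [e_j x e_k] is [+ e_1]; this can be
    done as the cross product is antisymmetric.  Then [e_1, e_j, e_k] multiply
    exactly as the standard basis of [R^3] does. *)

(** * Bilinear maps and bases *)

Section Bilinear.
Variable R : realType.

(** Stated for the bare property [linear], which is the form in which the
    partial applications of a bilinear product are known to be linear. *)
Lemma linear_sum_scale (U W : lmodType R) (f : U -> W) (I : Type) (s : seq I)
    (P : pred I) (c : I -> R) (x : I -> U) :
  linear f -> f (\sum_(i <- s | P i) c i *: x i) = \sum_(i <- s | P i) c i *: f (x i).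
Proof.
move=> lin_f; elim/big_rec2: _ => [|i y1 y2 _ <-]; last exact: lin_f.
by have := lin_f (-1) 0 0; rewrite scaler0 addr0 scaleN1r addNr.
Qed.

Lemma row_basis_sum n (a : 'rV[R]_n.+1) : a = \sum_i a 0 i *: basis R i.
Proof. exact: row_sum_delta. Qed.

Lemma bilinear_ext n (W : lmodType R) (f g : 'rV[R]_n.+1 -> 'rV[R]_n.+1 -> W) :
    (forall b, linear (f^~ b)) -> (forall a, linear (f a)) ->
    (forall b, linear (g^~ b)) -> (forall a, linear (g a)) ->
    (forall i j, f (basis R i) (basis R j) = g (basis R i) (basis R j)) ->
  forall a b, f a b = g a b.
Proof.
move=> fl fr gl gr fg a b; rewrite (row_basis_sum a).
rewrite (linear_sum_scale _ _ _ _ (fl b)) (linear_sum_scale _ _ _ _ (gl b)).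
apply: eq_bigr => i _; congr (_ *: _); rewrite (row_basis_sum b).
rewrite (linear_sum_scale _ _ _ _ (fr _)) (linear_sum_scale _ _ _ _ (gr _)).
by apply: eq_bigr => j _; rewrite fg.
Qed.

End Bilinear.

(** * Vidinli products *)

Section Vidinli.
Variables (R : realType) (n : nat).
Implicit Types (a b : 'rV[R]_n.+1) (cross : 'rV[R]_n.+1 -> 'rV[R]_n.+1 -> 'rV[R]_n.+1).

Lemma dotC a b : dot a b = dot b a.
Proof. by apply: eq_bigr => i _; rewrite mulrC. Qed.

Lemma dot_basisr a i : dot a (basis R i) = a 0 i.
Proof.
rewrite /dot (bigD1 i) //= mxE !eqxx mulr1 big1 ?addr0 // => j /negPf ji.
by rewrite mxE ji andbF mulr0.
Qed.

Lemma dot_linearl b : linear_for *%R ((@dot R n)^~ b).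
Proof.
move=> c u v; rewrite /dot mulr_sumr -big_split; apply: eq_bigr => i _.
by rewrite !mxE mulrDl mulrA.
Qed.

(** The inner products with [e_1] become first coordinates, and the two
    multiples of [e_1] are collected into one. *)
Lemma vidinliE cross a b :
  vidinli cross a b = a 0 ord0 *: b + b 0 ord0 *: a
    + (cross a b 0 ord0 - dot a b) *: basis R ord0.
Proof.
by rewrite /vidinli !dot_basisr [dot (basis _ _) _]dotC dot_basisr scalerBl addrA addrAC.
Qed.

Lemma vidinli_bilinear cross : is_bilinear cross -> is_bilinear (vidinli cross).
Proof.
move=> [crossl crossr]; split=> [b c u v|a c u v] /=; rewrite !vidinliE.
  rewrite [cross (_ + _) _]crossl [dot (_ + _) _]dot_linearl.
  by apply/rowP => i; rewrite !mxE; ring.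
rewrite [cross _ (_ + _)]crossr [dot _ (_ + _)]dotC.
rewrite [dot (_ + _) _]dot_linearl !(dotC _ a).
by apply/rowP => i; rewrite !mxE; ring.
Qed.

(** In the product of [e_1] and [a], the terms [<a, e_1> e_1] and
    [- <e_1, a> e_1] cancel, so only the first coordinate of the cross product
    can prevent [e_1] from being a unit. *)
Lemma vidinli_unit cross a :
  cross (basis R ord0) a 0 ord0 = 0 -> cross a (basis R ord0) 0 ord0 = 0 ->
  vidinli cross (basis R ord0) a = a /\ vidinli cross a (basis R ord0) = a.
Proof.
move=> c0 c0'; rewrite !vidinliE c0 c0' (dotC _ a) dot_basisr !mxE !eqxx.
by split; apply/rowP => i; rewrite !mxE /=; ring.
Qed.

Lemma vidinli_imaginary cross a b : a 0 ord0 = 0 -> b 0 ord0 = 0 ->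
  vidinli cross a b = (cross a b 0 ord0 - dot a b) *: basis R ord0.
Proof. by move=> a0 b0; rewrite vidinliE a0 b0 !scale0r !add0r. Qed.

Lemma basis_imaginary (j : 'I_n.+1) : j != ord0 -> basis R j 0 ord0 = 0.
Proof. by move=> j0; rewrite mxE eq_sym (negPf j0) andbF. Qed.

Lemma dot_basis (i j : 'I_n.+1) : dot (basis R i) (basis R j) = (i == j)%:R.
Proof. by rewrite dot_basisr mxE eqxx eq_sym. Qed.

End Vidinli.

(** * The cross products *)

Section Cross.
Variable R : realType.
Local Notation V := 'rV[R]_7.
Local Notation e := (basis R).
Local Notation e1 := (basis R ord0).
Implicit Types u v w : V.

Lemma omega_linearl i j k c u u' v w :
  omega i j k (c *: u + u') v w = c * omega i j k u v w + omega i j k u' v w.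
Proof. by rewrite !omegaE !mxE; ring. Qed.

Lemma omega_antisym i j k u v w : omega i j k v u w = - omega i j k u v w.
Proof. by rewrite !omegaE; ring. Qed.

Lemma omega_alt13 i j k u v : omega i j k u v u = 0.
Proof. by rewrite omegaE; ring. Qed.

Lemma omega_alt12 i j k u w : omega i j k u u w = 0.
Proof. by rewrite omegaE; ring. Qed.

Lemma cross7_antisym u v : cross7 v u = - cross7 u v.
Proof. by apply/rowP => k; rewrite !mxE /Phi !(omega_antisym _ _ _ u); ring. Qed.

(** Linearity on the right follows from linearity on the left by antisymmetry. *)
Lemma cross7_bilinear : is_bilinear (@cross7 R).
Proof.
have crossl b : linear ((@cross7 R)^~ b).
  by move=> c u v; apply/rowP => k; rewrite !mxE /Phi !omega_linearl; ring.
split=> // a c u v; rewrite cross7_antisym (crossl a).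
by rewrite opprD -scalerN -!cross7_antisym.
Qed.

Lemma cross7_diag u : cross7 u u = 0.
Proof. by apply/rowP => k; rewrite !mxE /Phi !omega_alt12; ring. Qed.

Lemma cross7_e1l u : cross7 e1 u 0 ord0 = 0.
Proof. by rewrite mxE /Phi !omega_alt13; ring. Qed.

Lemma cross7_e1r u : cross7 u e1 0 ord0 = 0.
Proof. by rewrite cross7_antisym mxE cross7_e1l oppr0. Qed.

Lemma vee7_bilinear : is_bilinear (@vee7 R).
Proof. exact/vidinli_bilinear/cross7_bilinear. Qed.

Lemma vee7_unit u : vee7 e1 u = u /\ vee7 u e1 = u.
Proof. exact: vidinli_unit (cross7_e1l u) (cross7_e1r u). Qed.

Lemma cross3_bilinear : is_bilinear (@cross3 R).
Proof. by split=> [b|a] c u v; apply/rowP => k; rewrite !mxE; ring. Qed.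

Lemma vee3_bilinear : is_bilinear (@vee3 R).
Proof. exact/vidinli_bilinear/cross3_bilinear. Qed.

Lemma cross3_0E (a b : 'rV[R]_3) :
  cross3 a b 0 ord0 = a 0 1 * b 0 2%:R - a 0 2%:R * b 0 1.
Proof. by rewrite mxE !add0r. Qed.

Lemma vee3_unit (a : 'rV[R]_3) : vee3 (basis R ord0) a = a /\ vee3 a (basis R ord0) = a.
Proof.
by apply: vidinli_unit; rewrite cross3_0E !mxE /= !(mul0r, mulr0) subrr.
Qed.

End Cross.

(** * Subgroups of order four *)

Section Klein.
Implicit Types (g h : cube) (H : {group cube}).

Lemma cube_addgg g : g + g = 0.
Proof.
by apply/rowP => i; rewrite !mxE; case: (g 0 i) => -[|[|[]]] // ?; apply/val_inj.
Qed.

Lemma cube_addKr g h : g + (g + h) = h.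
Proof. by rewrite addrA cube_addgg add0r. Qed.

Lemma cube_add_eq0 g h : (g + h == 0) = (g == h).
Proof.
apply/eqP/eqP => [gh0|->]; last exact: cube_addgg.
by rewrite -(cube_addKr g h) gh0 addr0.
Qed.

Lemma cube_eq_addr g h : (g == g + h) = (h == 0).
Proof. by rewrite -{1}[g]addr0 (inj_eq (addrI g)) eq_sym. Qed.

Lemma cube_eq_addl g h : (h == g + h) = (g == 0).
Proof. by rewrite addrC cube_eq_addr. Qed.

Definition klein g h : {set cube} := [set 0; g; h; g + h].

Lemma klein_group_set g h : group_set (klein g h).
Proof.
have gKr x : g + x + g = x by rewrite addrC cube_addKr.
apply/group_setP; split=> [|x y]; first by rewrite !inE eqxx.
rewrite FinRing.zmodMgE !inE -!orbA.
case/or4P=> /eqP-> /or4P[]/eqP->; rewrite ?(add0r, addr0, cube_addgg, cube_addKr, gKr);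
  rewrite ?[h + (g + h)]addrCA ?[h + g]addrC ?cube_addgg ?addr0 -?addrA ?cube_addgg ?addr0;
  by rewrite eqxx ?orbT.
Qed.

Canonical klein_group g h := Group (klein_group_set g h).

Lemma card_klein g h : g != 0 -> h != 0 -> g != h -> #|klein g h| = 4%N.
Proof.
move=> g0 h0 gh; have gh0 : g + h != 0 by rewrite cube_add_eq0.
have -> : klein g h = [set x in [:: 0; g; h; g + h]] by apply/setP=> x; rewrite !inE -!orbA.
rewrite cardsE; apply/card_uniqP; rewrite /= !inE !negb_or !(eq_sym 0) g0 h0 gh0 gh /=.
by rewrite cube_eq_addr cube_eq_addl g0 h0.
Qed.

Lemma order4_klein H g h : #|H| = 4%N -> g \in H -> h \in H ->
  g != 0 -> h != 0 -> g != h -> H :=: klein g h.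
Proof.
move=> cH gH hH g0 h0 gh; apply/esym/eqP; rewrite eqEcard card_klein // cH leqnn andbT.
apply/subsetP => x; rewrite !inE -!orbA => /or4P[]/eqP-> //; first exact: group1.
exact: groupM gH hH.
Qed.

(** Sharper than closure under addition: a subgroup of order 4 has only three
    nonzero elements, so the sum of two of them has to be the third. *)
Lemma order4_add H g h k : #|H| = 4%N -> g \in H -> h \in H -> k \in H ->
  g != 0 -> h != 0 -> k != 0 -> g != h -> g != k -> h != k -> g + h = k.
Proof.
move=> cH gH hH kH g0 h0 k0 gh gk hk; move: kH.
rewrite (order4_klein cH gH hH) // !inE (negPf k0) !(eq_sym k).
by rewrite (negPf gk) (negPf hk) => /eqP.
Qed.

Lemma label_eq (i j : 'I_7) : (label i == label j) = (i == j).
Proof. exact/inj_eq/label_inj. Qed.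

(** Distinct labels generate such a subgroup; a repeated label is first paired
    with any other one. *)
Lemma order4_through (j k : 'I_7) :
  exists H : {group cube}, [/\ #|H| = 4%N, label j \in H & label k \in H].
Proof.
wlog jk : k / j != k.
  move=> wl; case: (altP (j =P k)) => [<-|]; last exact: wl.
  have [k' jk'] : exists k' : 'I_7, j != k'.
    by exists (if j == ord0 then ord_max else ord0); case: ifP => [/eqP->|->].
  by have [H [cH jH _]] := wl k' jk'; exists H.
exists (klein_group (label j) (label k)); rewrite !inE !eqxx !orbT.
by rewrite card_klein ?label_neq0 ?label_eq.
Qed.

End Klein.

(** * The rules determine the product, and the Vidinli product obeys them *)

Section Rules.
Variable R : realType.
Local Notation V := 'rV[R]_7.
Local Notation e := (basis R).
Local Notation e1 := (basis R ord0).
Implicit Types (mul : V -> V -> V) (H : {group cube}).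

Lemma mem_subgroup_span H (j : 'I_7) : label j \in H -> e j \in subgroup_span R H.
Proof.
move=> jH; apply: memv_span; apply/imageP; exists (label j); last by rewrite labelK.
by rewrite !inE label_neq0.
Qed.

(** The spanning family consists of basis vectors with labels in [H], so the
    other coordinates vanish on the span. *)
Lemma subgroup_span_sum H (a : V) : a \in subgroup_span R H ->
  a = \sum_(i | label i \in H) a 0 i *: e i.
Proof.
move=> aW; suff supp i : label i \notin H -> a 0 i = 0.
  rewrite {1}[a]row_basis_sum (bigID (fun i => label i \in H)) /=.
  by rewrite [X in _ + X]big1 ?addr0 // => i /supp->; rewrite scale0r.
move=> iH; rewrite (coord_span aW) summxE big1 // => r _; rewrite mxE.
set x := nth _ _ _.
have /imageP[g] : x \in [seq e (idx g) | g in H :\ (0 : cube)].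
  by rewrite mem_nth // size_image.
rewrite !inE => /andP[g0 gH] ->; rewrite mxE; case: eqP => [_|]; last by rewrite mulr0.
by case: eqP => [ig|]; rewrite ?mulr0 //; move: iH; rewrite ig idxK // gH.
Qed.

(** Both products obey the same rule for a subgroup through the two labels.
    That rule fixes the value in all cases. *)
Lemma rules_determine_basis mul mul' (j k : 'I_7) :
  subalgebra_rules mul -> subalgebra_rules mul' -> mul (e j) (e k) = mul' (e j) (e k).
Proof.
move=> rm rm'; have [H [cH jH kH]] := order4_through j k.
have [ra rb] := rm H cH; have [ra' rb'] := rm' H cH.
have [jW kW] := (mem_subgroup_span jH, mem_subgroup_span kH).
have [H1|H1] := boolP (label ord0 \in H); last first.
  by rewrite (rb H1).2 ?(rb' H1).2.
have [[u r] [u' r']] := (ra H1, ra' H1).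
have [->|j0] := eqVneq j ord0; first by rewrite (u _ kW).1 (u' _ kW).1.
have [->|k0] := eqVneq k ord0; first by rewrite (u _ jW).2 (u' _ jW).2.
have [<-|jk] := eqVneq j k; last first.
  by have [_ _ -> _] := r j k jH kH j0 k0 jk; have [_ _ -> _] := r' j k jH kH j0 k0 jk.
(* The square of [e_j] is prescribed only together with a second imaginary
   label of [H]: the third nonzero element, [j] plus the label of [e_1]. *)
have jl0 : label j + label ord0 != 0 by rewrite cube_add_eq0 label_eq.
pose l := idx (label j + label ord0); have lE : label l = label j + label ord0 by exact: idxK.
have lH : label l \in H by rewrite lE; apply: groupM jH H1.
have l0 : l != ord0.
  by rewrite -label_eq lE eq_sym cube_eq_addl label_neq0.
have jl : j != l.
  by rewrite -label_eq lE cube_eq_addr label_neq0.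
by have [-> _ _ _] := r j l jH lH j0 l0 jl; have [-> _ _ _] := r' j l jH lH j0 l0 jl.
Qed.

Lemma rules_determine mul mul' : is_bilinear mul -> is_bilinear mul' ->
  subalgebra_rules mul -> subalgebra_rules mul' -> mul = mul'.
Proof.
move=> [ml mr] [ml' mr'] rm rm'; apply/funext => a; apply/funext => b.
by apply: bilinear_ext => // j k; apply: rules_determine_basis.
Qed.

(** Here the group structure meets the cross product: [e_j x e_k] has a
    component along [e_1] only if the labels of [e_j] and [e_k] add up to that
    of [e_1]. *)
Lemma cross7_basis_ord0 (j k : 'I_7) : j != k ->
  cross7 (e j) (e k) 0 ord0 = (label j + label k == label ord0)%:R * eps R j k.
Proof.
move=> jk; have jk0 : label j + label k != 0 by rewrite cube_add_eq0 label_eq.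
rewrite eps_cross7 // !mxE mulrC eqxx; congr (_%:R * _).
by rewrite -label_eq idxK // eq_sym.
Qed.

Lemma vee7_basis_diag (j : 'I_7) : j != ord0 -> vee7 (e j) (e j) = - e1.
Proof.
move=> j0; rewrite /vee7 vidinli_imaginary ?basis_imaginary //.
by rewrite cross7_diag mxE dot_basis eqxx sub0r scaleN1r.
Qed.

Lemma vee7_basis (j k : 'I_7) : j != ord0 -> k != ord0 -> j != k ->
  vee7 (e j) (e k) = cross7 (e j) (e k) 0 ord0 *: e1.
Proof.
move=> j0 k0 jk; rewrite /vee7 vidinli_imaginary ?basis_imaginary //.
by rewrite dot_basis (negPf jk) subr0.
Qed.

Lemma order4_label_add H (j k : 'I_7) : #|H| = 4%N -> label ord0 \in H ->
  label j \in H -> label k \in H -> j != ord0 -> k != ord0 -> j != k ->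
  label j + label k = label ord0.
Proof.
by move=> cH H1 jH kH j0 k0 jk; apply: (order4_add cH); rewrite ?label_neq0 ?label_eq.
Qed.

(** Labels in [H] have their sum in [H], hence never the label of [e_1]. *)
Lemma cross7_subgroup_span H a b : label ord0 \notin H ->
  a \in subgroup_span R H -> b \in subgroup_span R H -> cross7 a b 0 ord0 = 0.
Proof.
move=> H1 /subgroup_span_sum-> /subgroup_span_sum->.
have [cl cr] := cross7_bilinear R.
rewrite (linear_sum_scale _ _ _ _ (cl _)) summxE big1 // => j jH.
rewrite (linear_sum_scale _ _ _ _ (cr _)) mxE summxE big1 ?mulr0 // => k kH.
rewrite mxE; have [<-|jk] := eqVneq j k; first by rewrite cross7_diag mxE mulr0.
rewrite cross7_basis_ord0 //; case: eqP => [jk0|]; last by rewrite mul0r mulr0.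
by case/negP: H1; rewrite -jk0; apply: groupM jH kH.
Qed.

Lemma subgroup_span_imaginary H a : label ord0 \notin H ->
  a \in subgroup_span R H -> a 0 ord0 = 0.
Proof.
move=> H1 /subgroup_span_sum->; rewrite summxE big1 // => i iH.
by rewrite mxE basis_imaginary ?mulr0 //; apply: contraNneq H1 => <-.
Qed.

Lemma vee7_rules : subalgebra_rules (@vee7 R).
Proof.
move=> H cH; split=> H1; split; try by move=> a _; apply: vee7_unit.
  move=> j k jH kH j0 k0 jk; have kj : k != j by rewrite eq_sym.
  rewrite !vee7_basis_diag // !vee7_basis // !cross7_basis_ord0 //.
  by rewrite [label k + _]addrC (order4_label_add cH) // eqxx !mul1r.
move=> a b aW bW.
rewrite /vee7 vidinli_imaginary; try exact: (@subgroup_span_imaginary H).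
by rewrite (cross7_subgroup_span H1 aW bW) sub0r scaleNr.
Qed.

End Rules.

(** * Copies of the three-dimensional algebra *)

Section Copies.
Variable R : realType.
Local Notation V := 'rV[R]_7.
Local Notation e := (basis R).
Local Notation e1 := (basis R ord0).
Implicit Types H : {group cube}.

(** The two labels of [H] other than that of [e_1] satisfy [e_j x e_k = +- e_1];
    exchanging them changes the sign, so one of the two orders gives [+ e_1], as
    for the last two vectors of the standard basis of [R^3]. *)
Lemma order4_oriented_basis H : #|H| = 4%N -> label ord0 \in H ->
  exists j k : 'I_7, [/\ j != ord0, k != ord0, j != k,
    cross7 (e j) (e k) 0 ord0 = 1 & H :=: klein (label j) (label k)].
Proof.
move=> cH H1.
have /card_gt0P[g] : (0 < #|H :\: [set (0 : cube)%R; label ord0]|)%N.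
  rewrite cardsD cH subn_gt0 (leq_ltn_trans (subset_leq_card (subsetIr _ _))) //.
  by rewrite cards2; case: (_ == _).
rewrite !inE negb_or => /andP[/andP[g0 g1] gH].
pose j := idx g; have jE : label j = g by exact: idxK.
have h0 : label ord0 + g != 0 by rewrite cube_add_eq0 eq_sym.
pose k := idx (label ord0 + g); have kE : label k = label ord0 + g by exact: idxK.
have j0 : j != ord0 by rewrite -label_eq jE.
have k0 : k != ord0.
  by rewrite -label_eq kE eq_sym cube_eq_addr.
have jk : j != k.
  by rewrite -label_eq jE kE cube_eq_addl label_neq0.
have kH : label k \in H by rewrite kE; apply: groupM H1 gH.
rewrite -jE in gH.
have c_eps : cross7 (e j) (e k) 0 ord0 = eps R j k.
  by rewrite cross7_basis_ord0 // (order4_label_add cH) // eqxx mul1r.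
have kl (i l : 'I_7) : label i \in H -> label l \in H -> i != l ->
    H :=: klein (label i) (label l).
  by move=> iH lH il; apply: order4_klein; rewrite ?label_neq0 ?label_eq.
move: c_eps; rewrite /eps; case: ifP => _ c.
  by exists j, k; split=> //; apply: kl.
exists k, j; split=> //; try by rewrite eq_sym.
  by rewrite cross7_antisym mxE c opprK.
by apply: kl; rewrite // eq_sym.
Qed.

(** The copy is the image of the standard basis under the injection [sigma] of
    indices.  Vidinli products of imaginary basis vectors depend only on their
    inner products and on the first coordinate of their cross products, and
    [sigma] preserves both. *)
Lemma vee7_copy_of_V3 H : #|H| = 4%N -> label ord0 \in H ->
  copy_of_V3 (@vee7 R) (subgroup_span R H).
Proof.
move=> cH H1; have [j [k [j0 k0 jk c HE]]] := order4_oriented_basis cH H1.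
pose sigma (r : 'I_3) : 'I_7 := tnth [tuple ord0; j; k] r.
have sigma_inj : injective sigma.
  apply/tuple_uniqP; rewrite /= !inE negb_or !(eq_sym ord0) j0 k0 jk //.
have sigmaH r : label (sigma r) \in H.
  by case: r => -[|[|[|//]]] ? //; rewrite HE !inE eqxx ?orbT.
pose M : 'M[R]_(3, 7) := \matrix_(r < 3) e (sigma r).
pose f : 'Hom('rV[R]_3, V) := linfun (mulmxr M).
have f_basis r : f (basis R r) = e (sigma r).
  by rewrite lfunE /= -rowE rowK.
have f_lin : linear f by exact: linearP.
have f_scale x u : f (x *: u) = x *: f u by exact: linearZ.
have f_sum a : f a = \sum_r a 0 r *: e (sigma r).
  rewrite [in LHS](row_basis_sum a) (linear_sum_scale _ _ _ _ f_lin).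
  by apply: eq_bigr => r _; rewrite f_basis.
exists f; split.
- apply/eqP/lker0P => a b; rewrite !f_sum => fab; apply/rowP => r.
  have coordf (x : 'rV[R]_3) : (\sum_q x 0 q *: e (sigma q)) 0 (sigma r) = x 0 r.
    rewrite summxE (bigD1 r) //= !mxE !eqxx mulr1 big1 ?addr0 // => q qr.
    by rewrite !mxE (inj_eq sigma_inj) eq_sym (negPf qr) mulr0.
  by rewrite -coordf fab coordf.
- apply/eqP; rewrite eqEsubv; apply/andP; split.
    apply/subvP => _ /memv_imgP[a _ ->]; rewrite f_sum.
    by apply: memv_suml => r _; apply/memvZ/mem_subgroup_span.
  apply/span_subvP => _ /imageP[g + ->]; rewrite !inE => /andP[g0 gH].
  have [r ->] : exists r, idx g = sigma r.
    have s0 : label j + label k = label ord0.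
      by apply: (order4_label_add cH) => //; rewrite HE !inE eqxx ?orbT.
    move: gH; rewrite HE !inE (negPf g0) s0 /= => /orP[/orP[]|] /eqP->; rewrite labelK.
    - by exists 1.
    - by exists 2%:R.
    - by exists 0.
  by rewrite -f_basis memv_img ?memvf.
have [vl vr] := vee7_bilinear R; have [wl wr] := vee3_bilinear R.
apply: (bilinear_ext (f := fun a b => f (vee3 a b)) (g := fun a b => vee7 (f a) (f b))).
- by move=> b a u v /=; rewrite (wl b) f_lin.
- by move=> a b u v /=; rewrite (wr a) f_lin.
- by move=> b a u v /=; rewrite f_lin (vl (f b)).
- by move=> a b u v /=; rewrite f_lin (vr (f a)).
move=> r q; rewrite !f_basis.
(* Products with the unit are settled first; four imaginary pairs remain. *)
have [->|r0] := eqVneq r ord0.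
  by rewrite (vee3_unit _).1 f_basis (vee7_unit _).1.
have [->|q0] := eqVneq q ord0.
  by rewrite (vee3_unit _).2 f_basis (vee7_unit _).2.
rewrite /vee3 /vee7 !vidinli_imaginary ?basis_imaginary //; try
  by rewrite -[ord0 in X in _ != X]/(sigma ord0) (inj_eq sigma_inj).
rewrite f_scale f_basis !dot_basis (inj_eq sigma_inj); congr ((_ - _) *: _).
have c' : cross7 (e k) (e j) 0 ord0 = -1 by rewrite cross7_antisym mxE c.
rewrite cross3_0E; case: r r0 => -[|[|[|//]]] ? //; case: q q0 => -[|[|[|//]]] ? // _ _.
- by rewrite cross7_diag !mxE /=; ring.
- by rewrite [RHS]c !mxE /=; ring.
- by rewrite [RHS]c' !mxE /=; ring.
- by rewrite cross7_diag !mxE /=; ring.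
Qed.

End Copies.

Theorem theorem4p6 (R : realType) :
  [/\ exists! mul : 'rV[R]_7 -> 'rV[R]_7 -> 'rV[R]_7,
        is_bilinear mul /\ subalgebra_rules mul,
      forall mul : 'rV[R]_7 -> 'rV[R]_7 -> 'rV[R]_7,
        is_bilinear mul -> subalgebra_rules mul -> mul = @vee7 R
    & forall mul : 'rV[R]_7 -> 'rV[R]_7 -> 'rV[R]_7,
        is_bilinear mul -> subalgebra_rules mul ->
        forall H : {group cube}, #|H| = 4%N -> label ord0 \in H ->
        copy_of_V3 mul (subgroup_span R H)].
Proof.
have det mul : is_bilinear mul -> subalgebra_rules mul -> mul = @vee7 R.
  by move=> bm rm; apply: (rules_determine bm (vee7_bilinear R) rm (@vee7_rules R)).
split=> //.
  exists (@vee7 R); split; first by split; [exact: vee7_bilinear | exact: vee7_rules].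
  by move=> mul [bm rm]; rewrite (det mul).
by move=> mul bm rm H cH H1; rewrite (det mul) //; apply: vee7_copy_of_V3.
Qed.
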